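(* Let $y\in\mathbb{R}^n$ and let $(\hat u^{(k)})_{k\ge1}$, $(\hat b^{(k)})_{k\ge0}$, $(\hat y^{(k)})_{k\ge1}$ be the sequences produced by the Iterative Isotonic Regression algorithm applied to $y$: $\hat b^{(0)}=0$ and, for $k\ge1$, $\hat u^{(k)}=\mathrm{iso}(y-\hat b^{(k-1)})$, $\hat b^{(k)}=\mathrm{anti}(y-\hat u^{(k)})$, $\hat y^{(k)}=\hat u^{(k)}+\hat b^{(k)}$. Then $$\lim_{k\to\infty}\hat y^{(k)}=y.$$
   Context: Let $\mathcal{C}^+=\{u\in\mathbb{R}^n: u_1\le\dots\le u_n\}$ and $\mathcal{C}^-=-\mathcal{C}^+=\{b\in\mathbb{R}^n: b_1\ge\dots\ge b_n\}$. For $z\in\mathbb{R}^n$, $\mathrm{iso}(z)=\arg\min_{u\in\mathcal{C}^+}\|z-u\|^2$ and $\mathrm{anti}(z)=\arg\min_{b\in\mathcal{C}^-}\|z-b\|^2$ are the Euclidean metric projections of $z$ onto $\mathcal{C}^+$ and $\mathcal{C}^-$. *)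

(* Defs.v *)
From mathcomp Require Import all_boot all_order all_algebra.
From mathcomp Require Import all_classical all_reals all_analysis.
From mathcomp Require Import ring lra.

Set Implicit Arguments.
Unset Strict Implicit.
Unset Printing Implicit Defensive.

Import Order.TTheory GRing.Theory Num.Theory numFieldNormedType.Exports.

Local Open Scope classical_set_scope.
Local Open Scope ring_scope.

(* The library norm `|x| on 'rV[R]_n is the sup norm, so the squared Euclidean
   norm is introduced separately. *)
Definition sqnorm2 (R : realType) (n : nat) (x : 'rV[R]_n) : R :=
  \sum_(i < n) x 0 i ^+ 2.

Definition is_metric_proj (R : realType) (n : nat) (C : set 'rV[R]_n)
    (z u : 'rV[R]_n) : Prop :=
  C u /\ (forall v, C v -> sqnorm2 (z - u) <= sqnorm2 (z - v)).

(* arg min_(u in C) ||z - u||^2; the default value 0 is never used for the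
   two cones below, see isoP and antiP. *)
Definition metric_proj (R : realType) (n : nat) (C : set 'rV[R]_n)
    (z : 'rV[R]_n) : 'rV[R]_n :=
  xget 0 [set u | is_metric_proj C z u].

Definition Cplus (R : realType) (n : nat) : set 'rV[R]_n :=
  [set u | forall i j : 'I_n, (i <= j)%N -> u 0 i <= u 0 j].

Definition Cminus (R : realType) (n : nat) : set 'rV[R]_n :=
  [set b | forall i j : 'I_n, (i <= j)%N -> b 0 j <= b 0 i].

Definition iso (R : realType) (n : nat) (z : 'rV[R]_n) : 'rV[R]_n :=
  metric_proj (@Cplus R n) z.

Definition anti (R : realType) (n : nat) (z : 'rV[R]_n) : 'rV[R]_n :=
  metric_proj (@Cminus R n) z.

Lemma CminusE (R : realType) (n : nat) :
  @Cminus R n = [set - u | u in @Cplus R n].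
Proof.
apply/seteqP; split => [b bC|_ [u uC <-]] /=.
- exists (- b); last by rewrite opprK.
  by move=> i j ij; rewrite !mxE lerN2 bC.
- by move=> i j ij; rewrite !mxE lerN2 uC.
Qed.

Lemma sqnorm2_ge0 (R : realType) (n : nat) (x : 'rV[R]_n) : 0 <= sqnorm2 x.
Proof. by apply: sumr_ge0 => i _; exact: sqr_ge0. Qed.

Lemma sqnorm2_eq0 (R : realType) (n : nat) (x : 'rV[R]_n) :
  sqnorm2 x = 0 -> x = 0.
Proof.
move/eqP; rewrite psumr_eq0 => [/allP x0|i _]; last exact: sqr_ge0.
apply/rowP => i; rewrite !mxE; apply/eqP.
by have := x0 i (mem_index_enum _); rewrite /= sqrf_eq0.
Qed.

Lemma continuous_sqnorm2B (R : realType) (n : nat) (z : 'rV[R]_n) :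
  continuous (fun u : 'rV[R]_n => sqnorm2 (z - u)).
Proof.
apply: (continuous_big (U := R) (op := +%R)); first exact: add_continuous.
move=> i _ u.
have cu : {for u, continuous (fun v : 'rV[R]_n => (z - v) 0 i)}.
  have zB : {for u, continuous (fun v : 'rV[R]_n => z - v)}.
    apply: (@continuousB R _ _ (cst z) id u); first exact: cst_continuous.
    exact: cvg_id.
  exact: (continuous_comp zB (@coord_continuous R 1 n 0 i (z - u))).
exact: (continuousM cu cu).
Qed.

Lemma mx_norm_le_sqnorm2 (R : realType) (n : nat) (x : 'rV[R]_n) :
  `|x| <= Num.sqrt (sqnorm2 x).
Proof.
change (mx_norm x <= Num.sqrt (sqnorm2 x)).
have [->|] := eqVneq (mx_norm x) 0; first exact: sqrtr_ge0.
move/mx_norm_neq0 => [[k i] /= ->]; rewrite -sqrtr_sqr ler_wsqrtr//.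
rewrite ord1 /sqnorm2 (bigD1 i)//= lerDl.
by apply: sumr_ge0 => j _; exact: sqr_ge0.
Qed.

Lemma metric_proj_exists (R : realType) (n : nat) (C : set 'rV[R]_n)
    (z : 'rV[R]_n) :
  C 0 -> closed C -> exists u, is_metric_proj C z u.
Proof.
move=> C0 Ccl.
pose f u := sqnorm2 (z - u).
have fcont : continuous f by exact: continuous_sqnorm2B.
pose A := C `&` f @^-1` [set t | t <= f 0].
have A0 : A 0 by split => //=.
have Acl : closed A.
  apply: closedI => //; apply: preimage_closed; last exact: closed_le.
  by move=> u _; exact: fcont.
have Abnd : bounded_set A.
  exists (`|z| + Num.sqrt (f 0)); split; first exact: num_real.
  move=> M ltM u [_ /= fu]; apply: le_trans (ltW ltM).
  rewrite -[u](subKr z) (le_trans (ler_normB _ _))// lerD2l.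
  by rewrite (le_trans (mx_norm_le_sqnorm2 _))// ler_wsqrtr.
have [u /set_mem uA umin] := EVT_min_rV (ex_intro _ 0 A0)
  (bounded_closed_compact Abnd Acl) (continuous_subspaceT fcont).
exists u; split; first by case: uA.
move=> v Cv; have [fv|fv] := leP (f v) (f 0).
  by apply: umin; rewrite inE.
by apply: le_trans (ltW fv); apply: umin; rewrite inE.
Qed.

Lemma metric_proj_uniq (R : realType) (n : nat) (C : set 'rV[R]_n)
    (z u v : 'rV[R]_n) :
  (forall a b, C a -> C b -> C (2^-1 *: (a + b))) ->
  is_metric_proj C z u -> is_metric_proj C z v -> u = v.
Proof.
move=> Cmid [Cu umin] [Cv vmin].
have parallelogram : sqnorm2 (u - v) =
    2 * sqnorm2 (z - u) + 2 * sqnorm2 (z - v)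
    - 4 * sqnorm2 (z - 2^-1 *: (u + v)).
  rewrite /sqnorm2 !mulr_sumr -big_split -sumrB /=.
  by apply: eq_bigr => i _; rewrite !mxE; field.
apply/eqP; rewrite -subr_eq0; apply/eqP/sqnorm2_eq0/eqP.
rewrite eq_le sqnorm2_ge0 andbT.
have := umin _ (Cmid _ _ Cu Cv); have := vmin _ Cu; have := umin _ Cv.
rewrite parallelogram; lra.
Qed.

Lemma closed_Cplus (R : realType) (n : nat) : closed (@Cplus R n).
Proof.
have -> : @Cplus R n = \bigcap_(ij in [set ij : 'I_n * 'I_n | (ij.1 <= ij.2)%N])
    ((fun u : 'rV[R]_n => u 0 ij.2 - u 0 ij.1) @^-1` [set t | 0 <= t]).
  apply/seteqP; split => [u uC [i j] /= ij|u uC i j ij].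
    by rewrite subr_ge0 uC.
  by have := uC (i, j) ij; rewrite /= subr_ge0.
apply: closed_bigI => ij _; apply: preimage_closed; last exact: closed_ge.
move=> u _.
by apply: (@continuousB R R^o _ (fun u : 'rV[R]_n => u 0 ij.2)
  (fun u => u 0 ij.1)); exact: coord_continuous.
Qed.

Lemma closed_Cminus (R : realType) (n : nat) : closed (@Cminus R n).
Proof.
have -> : @Cminus R n = -%R @^-1` @Cplus R n.
  by apply/seteqP; split => u uC i j ij; have := uC i j ij; rewrite !mxE lerN2.
apply: preimage_closed; last exact: closed_Cplus.
by move=> u _; exact: opp_continuous.
Qed.

Lemma isoP (R : realType) (n : nat) (z u : 'rV[R]_n) :
  is_metric_proj (@Cplus R n) z u <-> u = iso z.
Proof.
have isoz : is_metric_proj (@Cplus R n) z (iso z).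
  apply: (xgetPex 0); apply: metric_proj_exists (@closed_Cplus R n).
  by move=> i j _; rewrite !mxE.
split => [zu|->//]; apply: metric_proj_uniq zu isoz => a b aC bC i j ij.
by rewrite !mxE ler_pM2l ?invr_gt0// lerD ?aC ?bC.
Qed.

Lemma antiP (R : realType) (n : nat) (z b : 'rV[R]_n) :
  is_metric_proj (@Cminus R n) z b <-> b = anti z.
Proof.
have antiz : is_metric_proj (@Cminus R n) z (anti z).
  apply: (xgetPex 0); apply: metric_proj_exists (@closed_Cminus R n).
  by move=> i j _; rewrite !mxE.
split => [zb|->//]; apply: metric_proj_uniq zb antiz => a c aC cC i j ij.
by rewrite !mxE ler_pM2l ?invr_gt0// lerD ?aC ?cC.
Qed.

(* Main.v *)
Require Import Defs.
From mathcomp Require Import all_boot all_order all_algebra.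
From mathcomp Require Import all_classical all_reals all_analysis.
From mathcomp Require Import ring lra.
Import Order.TTheory GRing.Theory Num.Theory numFieldNormedType.Exports.
Local Open Scope classical_set_scope.
Local Open Scope ring_scope.

(** Every [y] splits as [y = u + b] with [u] nondecreasing and [b]
nonincreasing ([Cplus_Cminus_decomposition]), so the closed convex cone [Cplus]
and its translate [y - Cminus = y + Cplus] meet at [u].  The algorithm is the
method of alternating projections between these two sets: [uhat k] projects
[y - bhat k.-1] onto the first one and [y - bhat k] projects [uhat k] onto the
second one.  By the Pythagorean inequality for projections onto convex sets
([metric_proj_pythagoras]), each projection brings the iterate closer to [u]:
the squared distance to [u], equivalently that of [bhat k] to [b], drops by
at least the squared length of the step, and the step that produces [bhat k]
has the residual [y - yhat k] as displacement.  A nonincreasing sequence of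
nonnegative reals has decrements tending to [0], hence so do the residuals. *)

(** The point [u + t (v - u)] of the segment from [u] to [v] is no closer to
[z] than [u] is; expanding its squared distance to [z] and dividing by [t]
gives the inequality with an extra [t * sqnorm2 (u - v)] on the right, which
vanishes with [t]. *)
Lemma metric_proj_pythagoras {R : realType} {n : nat} {C : set 'rV[R]_n}
    {z u v : 'rV[R]_n} :
  (forall (t : R) a b, 0 <= t <= 1 -> C a -> C b ->
    C ((1 - t) *: a + t *: b)) ->
  is_metric_proj C z u -> C v ->
  sqnorm2 (z - u) + sqnorm2 (u - v) <= sqnorm2 (z - v).
Proof.
move=> Cconv [Cu umin] Cv.
have segment t : 0 < t <= 1 ->
    sqnorm2 (z - u) + sqnorm2 (u - v) <= sqnorm2 (z - v) + t * sqnorm2 (u - v).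
  move=> /andP[t0 t1].
  have t01 : 0 <= t <= 1 by rewrite ltW.
  have := umin _ (Cconv t u v t01 Cu Cv).
  have -> : sqnorm2 (z - ((1 - t) *: u + t *: v)) = sqnorm2 (z - u)
      + t * (sqnorm2 (z - v) + t * sqnorm2 (u - v)
             - (sqnorm2 (z - u) + sqnorm2 (u - v))).
    rewrite /sqnorm2 [in RHS]mulr_sumr -!big_split -sumrB mulr_sumr -big_split /=.
    by apply: eq_bigr => i _; rewrite !mxE; ring.
  by rewrite lerDl pmulr_rge0// subr_ge0.
rewrite leNgt; apply/negP => gap.
set B := sqnorm2 (u - v) in segment gap *.
pose D := sqnorm2 (z - u) + B - sqnorm2 (z - v).
have D0 : 0 < D by rewrite subr_gt0.
have DB : D <= B by have := segment 1; rewrite ltr01 lexx mul1r /D => /(_ isT); lra.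
have B0 : 0 < B by exact: lt_le_trans DB.
(* with this [t] the extra term is half of the supposed gap [D] *)
have := segment (D / (2 * B)).
have -> : D / (2 * B) * B = D / 2 by field; rewrite gt_eqF.
rewrite divr_gt0 ?mulr_gt0// ler_pdivrMr ?mulr_gt0// => /(_ _).
have -> : D <= 1 * (2 * B) by lra.
by move=> /(_ isT); rewrite /D in D0 *; lra.
Qed.

Lemma Cplus_convex {R : realType} {n : nat} (t : R) (a b : 'rV[R]_n) :
  0 <= t <= 1 -> @Cplus R n a -> @Cplus R n b ->
  @Cplus R n ((1 - t) *: a + t *: b).
Proof.
move=> /andP[t0 t1] aC bC i j ij; rewrite !mxE.
by rewrite lerD// ler_wpM2l ?subr_ge0 ?aC ?bC.
Qed.

Lemma Cminus_convex {R : realType} {n : nat} (t : R) (a b : 'rV[R]_n) :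
  0 <= t <= 1 -> @Cminus R n a -> @Cminus R n b ->
  @Cminus R n ((1 - t) *: a + t *: b).
Proof.
move=> /andP[t0 t1] aC bC i j ij; rewrite !mxE.
by rewrite lerD// ler_wpM2l ?subr_ge0 ?aC ?bC.
Qed.

(** A linear ramp [i |-> i * M] that is steep enough dominates all the
increments of [y], so that subtracting it makes [y] nonincreasing. *)
Lemma Cplus_Cminus_decomposition {R : realType} {n : nat} (y : 'rV[R]_n) :
  exists u b, [/\ @Cplus R n u, @Cminus R n b & y = u + b].
Proof.
pose S := \sum_(i < n) `|y 0 i|.
have yS i : `|y 0 i| <= S by rewrite /S (bigD1 i)//= lerDl sumr_ge0.
have S0 : 0 <= S by exact: sumr_ge0.
pose ramp : 'rV[R]_n := \row_i (i%:R * (2 * S)).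
exists ramp, (y - ramp); split; last by rewrite addrC subrK.
  by move=> i j ij; rewrite !mxE ler_wpM2r ?mulr_ge0// ler_nat.
move=> i j; rewrite leq_eqVlt => /predU1P[/val_inj -> //|ij]; rewrite !mxE.
have : (i%:R + 1) * (2 * S) <= j%:R * (2 * S).
  by rewrite ler_wpM2r ?mulr_ge0// natr1 ler_nat.
have := yS i; have := yS j; rewrite !ler_norml => /andP[_ yj] /andP[yi _].
lra.
Qed.

Lemma nonincreasing_ge0_decrement_cvg0 {R : realType} {a r : nat -> R} :
  (forall k, 0 <= a k) -> (forall k, 0 <= r k) ->
  (forall k, r k + a k.+1 <= a k) -> r k @[k --> \oo] --> (0 : R).
Proof.
move=> a0 r0 ra.
have acvg : cvgn a.
  apply: nonincreasing_is_cvgn.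
    by apply/nonincreasing_seqP => k; apply: le_trans (ra k); rewrite lerDr.
  by exists 0 => _ [k _ <-].
have decr : (a k - a k.+1) @[k --> \oo] --> (0 : R).
  rewrite -(subrr (limn a)); apply: cvgB; first exact: acvg.
  by rewrite (cvg_shiftS a).
apply: squeeze_cvgr (cvg_cst 0) decr.
by apply: nearW => k; rewrite r0 lerBrDr ra.
Qed.

Lemma sqnorm2_cvg0 {R : realType} {n : nat} {x : nat -> 'rV[R]_n} :
  sqnorm2 (x k) @[k --> \oo] --> (0 : R) -> x k @[k --> \oo] --> (0 : 'rV[R]_n).
Proof.
move=> x0; apply/norm_cvg0P.
have sqrtx0 : Num.sqrt (sqnorm2 (x k)) @[k --> \oo] --> (0 : R).
  rewrite -[X in _ --> X]sqrtr0.
  by apply: continuous_cvg x0; exact: sqrt_continuous.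
apply: squeeze_cvgr (cvg_cst 0) sqrtx0.
by apply: nearW => k; rewrite normr_ge0 mx_norm_le_sqnorm2.
Qed.

Theorem proposition1 (R : realType) (n : nat) (y : 'rV[R]_n)
    (uhat bhat yhat : nat -> 'rV[R]_n)
    (bhat0 : bhat 0%N = 0)
    (uhatE : forall k : nat, (1 <= k)%N -> uhat k = iso (y - bhat k.-1))
    (bhatE : forall k : nat, (1 <= k)%N -> bhat k = anti (y - uhat k))
    (yhatE : forall k : nat, (1 <= k)%N -> yhat k = uhat k + bhat k) :
  yhat k @[k --> \oo] --> y.
Proof.
have [u [b [uC bC yE]]] := Cplus_Cminus_decomposition y.
pose a k := sqnorm2 (bhat k - b).
have descent k : sqnorm2 (y - yhat k.+1) + a k.+1 <= a k.
  have uproj := metric_proj_pythagoras (@Cplus_convex R n)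
    ((isoP _ _).2 (uhatE k.+1 isT)) uC.
  have bproj := metric_proj_pythagoras (@Cminus_convex R n)
    ((antiP _ _).2 (bhatE k.+1 isT)) bC.
  have sqnorm2N (x : 'rV[R]_n) : sqnorm2 (- x) = sqnorm2 x.
    by apply: eq_bigr => i _; rewrite !mxE sqrrN.
  have ub : y - uhat k.+1 - b = - (uhat k.+1 - u).
    by rewrite yE; apply/rowP => i; rewrite !mxE; ring.
  have bu : y - bhat k - u = - (bhat k - b).
    by rewrite yE; apply/rowP => i; rewrite !mxE; ring.
  rewrite ub sqnorm2N -addrA -opprD -yhatE// in bproj.
  rewrite [k.+1.-1]/= bu sqnorm2N in uproj.
  apply: le_trans bproj (le_trans _ uproj).
  by rewrite lerDr sqnorm2_ge0.
have residual0 : (y - yhat k.+1) @[k --> \oo] --> (0 : 'rV[R]_n).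
  apply: sqnorm2_cvg0.
  by apply: nonincreasing_ge0_decrement_cvg0 descent => k; exact: sqnorm2_ge0.
rewrite -(cvg_shiftS yhat).
have -> : (fun k => yhat k.+1) = (fun k => y - (y - yhat k.+1)).
  by apply/funext => k; rewrite subKr.
by have := cvgB (cvg_cst y) residual0; rewrite subr0; apply.
Qed.
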